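(* Consider the networked control system (NCS) described in the context without external disturbance ($w=0$), with packet-drop process given by a state-dependent dropout channel (SDDC) with dropout probabilities $\theta(s,p)$. Suppose that there are functions $V_0,V_1$ of the state of the switched system $z_{k+1}=f_{\gamma_k}(z_k,w_k)$, class $\mathcal K_\infty$ functions $\alpha_1,\alpha_2$, a class $\mathcal K$ function $\chi$, and constants $\varrho,\lambda_0,\lambda_1>0$ (where $\lambda_0>\lambda_1$ and $\varrho\lambda_1<1$) such that for all states $y$ and disturbances $w$: $\alpha_1(|y|)\le V_i(y)\le\alpha_2(|y|)$ for $i\in\{0,1\}$; $V_i(f_i(y,w))\le\lambda_iV_i(y)+\chi(|w|)$ for $i\in\{0,1\}$; $V_i(y)\le\varrho V_j(y)$ for $i\ne j$ in $\{0,1\}$; and $\varrho\min_i\lambda_i<1$. Let $\mu=\{\mu_k\}$ be a selected joint policy. (i) If for all $k\in\mathbb Z_{\ge0}$ and all $(s,p)\in S\times\Omega_p$ $$\sum_{s'\in S,\;p'\in\Omega_p}\theta(s',p')\,\mu_k^p(p')\sum_{a\in A(s)}p(s'|s,a)\,\mu_k^m(a)<\frac{1-\lambda_1\varrho}{\varrho(\lambda_0-\lambda_1)},$$ where $\mu_k^p(p')=\mathbb P\{p'\mid s_k=s\}$ and $\mu_k^m(a)=\mathbb P\{a\mid s_k=s\}$, then the NCS is almost surely asymptotically safe (ASAS) with respect to $\Omega_s=\{x\in\mathbb R^n:|x|\le r\}$, for every $r>0$. (ii) If there exists $\eta\in[0,1)$ such that the same inequality holds, for all $k\in\mathbb Z_{\ge0}$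 and all $(s,p)\in S\times\Omega_p$, with the right-hand side replaced by $\frac{\eta-\lambda_1\varrho}{\varrho(\lambda_0-\lambda_1)}$, then the NCS is almost surely exponentially safe, i.e. there exist $\kappa(r)>0$ and a class $\mathcal K_\infty$ function $\alpha$ such that $\mathbb P\{\sup_{k\ge k'}|x_k|\ge r\}\le\kappa(r)\,\eta^{k'}\alpha(|x_0|)$.
   Context: Notation. $|\cdot|$ is the infinity norm of a vector. A function $\alpha:\mathbb R_{\ge0}\to\mathbb R_{\ge0}$ is of class $\mathcal K$ if it is continuous, strictly increasing and $\alpha(0)=0$; it is of class $\mathcal K_\infty$ if moreover it is radially unbounded. A function $\beta:\mathbb R_{\ge0}^2\to\mathbb R_{\ge0}$ is of class $\mathcal{KL}$ if $\beta(\cdot,t)$ is of class $\mathcal K_\infty$ for each fixed $t\ge0$ and $\beta(s,t)\to0$ as $t\to\infty$ for each $s\ge0$. A function $\xi:\mathbb R_{\ge0}^3\to\mathbb R_{\ge0}$ is of class $\mathcal{KLL}$ if for each $r\ge0$ both $\xi(\cdot,\cdot,r)$ and $\xi(\cdot,r,\cdot)$ are of class $\mathcal{KL}$. MDP. A Markov decision process (MDP) has finite state set $S=\{1,\dots,N\}$, finite action set $A$ (with $A(s)$ the actions available at $s$), and transition probabilities $p(s'|s,a)$ from $s$ to $s'$ under action $a$. $\Omega_p=\{p_1,\dots,p_M\}$ is a finite set of transmission power levels. Joint policy and joint chain. A joint policy $\mu=\{\mu_k\}_{k\ge0}$, $\mu_k=(\mu_k^m,\mu_k^p)$, consists of randomized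 decision rules $\mu_k^m(a)=\mathbb P\{a\mid s_k=s\}$ on actions and $\mu_k^p(p')=\mathbb P\{p'\mid s_k=s\}$ on power levels. The joint state $\overline s_k=(s_k,p_k)$ is a Markov chain on $S\times\Omega_p$ with transition probabilities from $\overline s=(s,p)$ to $\overline s'=(s',p')$ at time $k$ $$\overline P_k(\overline s,\overline s')=\mathbb P\{\overline s_{k+1}=\overline s'\mid\overline s_k=\overline s\}=\mu_k^p(p')\sum_{a\in A(s)}p(s'|s,a)\mu_k^m(a).$$ SDDC. $\gamma_k\in\{0,1\}$, where $\gamma_k=1$ means the packet at time $k$ is received and $\gamma_k=0$ that it is dropped. For all $i\in S$, $p\in\Omega_p$, $k\in\mathbb Z_{\ge0}$: $\mathbb P\{\gamma_k=0\mid s_k=i,p_k=p\}=\theta(i,p)\in[0,1)$, where $\theta(i,p)$ is monotonically decreasing in $p$. Given the joint states, the $\gamma_k$ are conditionally independent over time. NCS. $x_{k+1}=f(x_k,u_k,w_k)$ with $x_k\in\mathbb R^n$, $u_k\in\mathbb R^l$, $w_k\in\mathbb R^m$; $\hat x_k=\gamma_kx_k+(1-\gamma_k)\hat x_{k-1}$ with zero initial estimate $\hat x_{-1}=0$; $u_k=K(\hat x_k)$ for a map $K:\mathbb R^n\to\mathbb R^l$. With $z_k=[x_k;\hat x_{k-1}]\in\mathbb R^{2n}$ the closed loop is the randomly switched system $z_{k+1}=f_{\gamma_k}(z_k,w_k)$. Multiple-Lyapunov-function assumption. There are functions $V_0,V_1$ of the state of the switched system, class $\mathcal K_\infty$ functions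 $\alpha_1,\alpha_2$, a class $\mathcal K$ function $\chi$, and constants $\varrho,\lambda_0,\lambda_1>0$ such that for all states $y$ and disturbances $w$: (V1) $\alpha_1(|y|)\le V_i(y)\le\alpha_2(|y|)$ for $i\in\{0,1\}$; (V2) $V_i(f_i(y,w))\le\lambda_iV_i(y)+\chi(|w|)$ for $i\in\{0,1\}$; (V3) $V_i(y)\le\varrho V_j(y)$ for $i\ne j$; (V4) $\varrho\min_i\lambda_i<1$. It is understood that $\lambda_0>\lambda_1$, so that $\varrho\lambda_1<1$. ASAS. With $w=0$, the NCS is almost surely asymptotically safe with respect to $\Omega_s=\{x:|x|\le r\}$ if for all $\epsilon\in(0,1]$ and $k'>0$ there exist a class $\mathcal{KLL}$ function $\xi$ and a bounded set $\Omega_{r'}=\{x\in\mathbb R^n:|x|<r'\}$, $r'=r'(\epsilon,r)>0$, such that for all $x_0\in\Omega_{r'}$: $\mathbb P\{\sup_{k\ge k'}|x_k|\ge r\}\le\xi(|x_0|,k',r)\le\epsilon$, and $\mathbb P\{\lim_{k'\to\infty}\sup_{k\ge k'}|x_k|\ge r\}=0$. *)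

(* Defs.v *)
From HB Require Import structures.
From mathcomp Require Import all_boot all_order all_algebra.
From mathcomp Require Import finmap.
From mathcomp Require Import all_classical all_reals all_analysis.

Set Implicit Arguments.
Unset Strict Implicit.
Unset Printing Implicit Defensive.

Import Order.TTheory GRing.Theory Num.Theory.
Import numFieldNormedType.Exports.

Local Open Scope classical_set_scope.
Local Open Scope ring_scope.

(* Comparison functions: functions on [0, +oo[ are represented by functions   *)
(* on R of which only the restriction to [0, +oo[ is constrained; values are  *)
(* nonnegative there because they are 0 at 0 and increase.                    *)

Definition classK (R : realType) (a : R -> R) : Prop :=
  [/\ {within `[0, +oo[, continuous a},
      (forall s t, 0 <= s -> s < t -> a s < a t) & a 0 = 0].

Definition classKoo (R : realType) (a : R -> R) : Prop :=
  classK a /\ a s @[s --> +oo] --> +oo.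

Definition classKL (R : realType) (b : R -> R -> R) : Prop :=
  (forall t, 0 <= t -> classKoo (b ^~ t)) /\
  (forall s, 0 <= s -> b s t @[t --> +oo] --> (0 : R)).

Definition classKLL (R : realType) (xi : R -> R -> R -> R) : Prop :=
  forall r, 0 <= r ->
    classKL (fun s t => xi s t r) /\ classKL (fun s t => xi s r t).

Definition distr (R : realType) (X : finType) (q : X -> R) : Prop :=
  (forall x, 0 <= q x) /\ \sum_x q x = 1.

Record mdp (R : realType) (N : nat) (A : finType) := MDP {
  avail : 'I_N -> {set A};
  (* [trans s a s'] is p(s' | s, a) *)
  trans : 'I_N -> A -> 'I_N -> R;
  trans_distr : forall s a, a \in avail s -> distr (trans s a) }.

(* [act_rule mu k s a] is mu_k^m(a) = P{a | s_k = s} and [pow_rule mu k s p]  *)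
(* is mu_k^p(p) = P{p | s_k = s}.                                             *)
Record policy (R : realType) (N : nat) (A : finType) (M : mdp R N A)
    (Omegap : {fset R}) := Policy {
  act_rule : nat -> 'I_N -> A -> R;
  pow_rule : nat -> 'I_N -> Omegap -> R;
  act_rule_distr : forall k s, distr (act_rule k s);
  act_rule_avail : forall k s a, a \notin avail M s -> act_rule k s a = 0;
  pow_rule_distr : forall k s, distr (pow_rule k s) }.

Definition joint_trans (R : realType) (N : nat) (A : finType) (M : mdp R N A)
    (Omegap : {fset R}) (mu : policy M Omegap) (k : nat)
    (sp sp' : 'I_N * Omegap) : R :=
  pow_rule mu k sp.1 sp'.2 *
  \sum_(a in avail M sp.1) trans M sp.1 a sp'.1 * act_rule mu k sp.1 a.

Section processes.
Context (d : measure_display) (T : measurableType d) (R : realType).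
Variable P : probability T R.

(* Meaningful only when [P B] is nonzero; it is always used under a guard. *)
Definition cprob (E B : set T) : R := fine (P (E `&` B)) / fine (P B).

(* Measurability of a map with finitely many values. *)
Definition discrete_rv (X : finType) (Z : T -> X) : Prop :=
  forall x, measurable (Z @^-1` [set x]).

Definition history (X : Type) (Z : nat -> T -> X) (path : nat -> X) (k : nat) :
  set T := [set w | forall j, (j <= k)%N -> Z j w = path j].

(* Time-inhomogeneous Markov chain with one-step kernels [Q k]; the initial   *)
(* distribution is arbitrary.                                                 *)
Definition markov_chain (X : finType) (Q : nat -> X -> X -> R)
    (Z : nat -> T -> X) : Prop :=
  (forall k, discrete_rv (Z k)) /\
  forall k (path : nat -> X), (0 < P (history Z path k))%E ->
    cprob [set w | Z k.+1 w = path k.+1] (history Z path k)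
      = Q k (path k) (path k.+1).

(* State-dependent dropout channel: [gam k w = true] iff the packet of time   *)
(* [k] is received.  In the last clause, the conditional law of the dropouts  *)
(* up to time [k] given the joint states up to time [k] is the product of the *)
(* individual laws of each [gam j] given the joint state of time [j].         *)
Definition sddc (N : nat) (Omegap : {fset R}) (theta : 'I_N -> Omegap -> R)
    (sp : nat -> T -> 'I_N * Omegap) (gam : nat -> T -> bool) : Prop :=
  [/\ (forall i p, 0 <= theta i p < 1),
      (forall i (p p' : Omegap), val p <= val p' -> theta i p' <= theta i p),
      (forall k, discrete_rv (gam k)),
      (forall k i p, (0 < P [set w | sp k w = (i, p)])%E ->
         cprob [set w | gam k w = false] [set w | sp k w = (i, p)]
           = theta i p) &
      (forall k (path : nat -> 'I_N * Omegap) (g : nat -> bool),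
         (0 < P (history sp path k))%E ->
         cprob (history gam g k) (history sp path k)
           = \prod_(j < k.+1)
               cprob [set w | gam j w = g j] [set w | sp j w = path j])].

End processes.

Section ncs.
Context (R : realType) (n l m : nat).
Variable f : 'cV[R]_n -> 'cV[R]_l -> 'cV[R]_m -> 'cV[R]_n.
Variable K : 'cV[R]_n -> 'cV[R]_l.

(* hat x_k as a function of gamma_k, x_k and hat x_(k-1). *)
Definition estimate (g : bool) (x xh : 'cV[R]_n) : 'cV[R]_n :=
  g%:R *: x + (1 - g%:R) *: xh.

(* The map f_gamma on z_k = [x_k; hat x_(k-1)]. *)
Definition switched (g : bool) (z : 'cV[R]_(n + n)) (w : 'cV[R]_m) :
    'cV[R]_(n + n) :=
  let xh := estimate g (usubmx z) (dsubmx z) in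
  col_mx (f (usubmx z) (K xh) w) xh.

Fixpoint ncs_z (g : nat -> bool) (w : nat -> 'cV[R]_m) (x0 : 'cV[R]_n)
    (k : nat) : 'cV[R]_(n + n) :=
  if k is k'.+1 then switched (g k') (ncs_z g w x0 k') (w k')
  else col_mx x0 0.

Definition ncs_x g w x0 k : 'cV[R]_n := usubmx (ncs_z g w x0 k).

End ncs.

(* Index [false] stands for 0 and [true] for 1.  The norm on column vectors   *)
(* is the library's one, i.e. the infinity norm.                              *)
Definition multiple_lyapunov (R : realType) (q m : nat)
    (F : bool -> 'cV[R]_q -> 'cV[R]_m -> 'cV[R]_q) (V : bool -> 'cV[R]_q -> R)
    (alpha1 alpha2 chi : R -> R) (rho : R) (lam : bool -> R) : Prop :=
  [/\ (forall i y, alpha1 `|y| <= V i y <= alpha2 `|y|),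
      (forall i y w, V i (F i y w) <= lam i * V i y + chi `|w|),
      (forall i j y, i != j -> V i y <= rho * V j y) &
      rho * Num.min (lam false) (lam true) < 1].

Section safety.
Context (d : measure_display) (T : measurableType d) (R : realType).
Variable P : probability T R.
Context (n : nat).
(* [X x0 k w] is the state at time [k] on outcome [w] when it starts at [x0]. *)
Variable X : 'cV[R]_n -> nat -> T -> 'cV[R]_n.

Local Open Scope ereal_scope.

(* sup_{k >= k'} |x_k| is [esups _ k'], an extended real. *)
Definition tail_sup (x0 : 'cV[R]_n) (w : T) : nat -> \bar R :=
  esups (fun k => `|X x0 k w|%:E).

(* Almost sure asymptotic safety with respect to the closed ball of radius r. *)
(* The radius r' depends on [eps] and [r] only, not on [k'].                  *)
Definition ASAS (r : R) : Prop :=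
  forall eps : R, (0 < eps <= 1)%R ->
  exists2 r' : R, (0 < r')%R &
  forall k' : nat, (0 < k')%N ->
  exists2 xi : R -> R -> R -> R, classKLL xi &
  forall x0 : 'cV[R]_n, (`|x0| < r')%R ->
  [/\ P [set w | r%:E <= tail_sup x0 w k'] <= (xi `|x0| k'%:R r)%:E,
      (xi `|x0| k'%:R r <= eps)%R &
      P [set w | r%:E <= limn (tail_sup x0 w)] = 0].

(* Almost sure exponential safety with rate [eta]. *)
Definition ASES (eta : R) : Prop :=
  exists (kappa : R -> R) (alpha : R -> R),
  classKoo alpha /\
  forall r : R, (0 < r)%R ->
    (0 < kappa r)%R /\
    forall (x0 : 'cV[R]_n) (k' : nat),
      P [set w | r%:E <= tail_sup x0 w k']
        <= (kappa r * eta ^+ k' * alpha `|x0|)%:E.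

End safety.

(* Main.v *)
Require Import Defs.
From HB Require Import structures.
From mathcomp Require Import all_boot all_order all_algebra.
From mathcomp Require Import finmap.
From mathcomp Require Import all_classical all_reals all_analysis.
From mathcomp Require Import measurable_realfun ring lra.

Set Implicit Arguments.
Unset Strict Implicit.
Unset Printing Implicit Defensive.

Import Order.TTheory GRing.Theory Num.Theory.
Import numFieldNormedType.Exports.

Local Open Scope classical_set_scope.
Local Open Scope ring_scope.

(* The Lyapunov assumption gives                                              *)
(*   alpha1 |x_k| <= rho * alpha2 |x_0| * \prod_(j < k) (rho * lam (gam j)),   *)
(* and by the Markov property the conditional mean of the factor of time      *)
(* [k >= 1] given the joint states before [k] is an affine function of the    *)
(* conditional drop probability.  In (ii) it is less than eta, so that the    *)
(* expected product is O(eta ^ k), and Markov's inequality with a union bound *)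
(* over k >= k' concludes.  In (i) the conditional means are less than 1 but  *)
(* not uniformly in time.  The conditional means of the square roots of the   *)
(* factors, however, are bounded by a constant less than 1: by strict         *)
(* concavity if rho * lam false > 1, and otherwise because the drop           *)
(* probabilities are bounded away from 1.                                     *)

(** Both parts are instances of one statement, [contraction_safety]. Suppose that a state of norm at
    least s at time k forces b(s) <= alpha(|x_0|) * prod_(j < k) c(gamma_j), and that the
    conditional mean of each factor c(gamma_(k+1)) given the joint state at time k is at most some
    eta < 1. The pair (s_k, p_k), gamma_k is again a Markov chain ([prob_trace_step]), so the
    expected product decays like eta^k ([exp_weight_geometric]). Markov's inequality and a geometric
    union bound over times k >= k' then give an exponential tail ([tail_prob_le]). Letting k' grow
    makes the limit event null ([lim_tail_null]). The Lyapunov functions supply the pathwise bound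
    ([ncs_x_bound]). Part (ii) takes c = rho * lam. Part (i) takes square roots of everything,
    because means below 1 need not have a product tending to 0, whereas [sqrt_contraction] turns
    them into a single rate eta < 1. This yields exponential safety with some rate, and [ASES_ASAS]
    converts it. All expectations are finite sums over words of observed values, so no integral
    occurs. *)

Section trace.
Context (d : measure_display) (T : measurableType d) (Y : finType).
Variable Z : nat -> T -> Y.

(** Values at the times before k, latest first, so that one more time step is a [cons]. *)
Fixpoint trace (k : nat) (w : T) : seq Y :=
  if k is k'.+1 then Z k' w :: trace k' w else [::].

Fixpoint words (k : nat) : seq (seq Y) :=
  if k is k'.+1 then [seq y :: s | s <- words k', y <- enum Y] else [:: [::]].

Lemma size_words k s : s \in words k -> size s = k.
Proof.
elim: k s => [|k ih] s /=; first by rewrite inE => /eqP ->.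
by case/allpairsP => -[s' y] /= [/ih <- _ ->].
Qed.

Lemma rev_trace k w : rev (trace k w) = mkseq (Z^~ w) k.
Proof. by elim: k => //= k ih; rewrite rev_cons ih mkseqS. Qed.

Lemma history_trace (u : nat -> Y) k :
  history Z u k = [set w | trace k.+1 w = rev (mkseq u k.+1)].
Proof.
apply/seteqP; split=> w /=.
  move=> h; rewrite -[LHS]revK -[Z k w :: _]/(trace k.+1 w) rev_trace; congr rev.
  apply: (@eq_from_nth _ (u 0)); rewrite ?size_mkseq// => i ik.
  by rewrite !nth_mkseq// h.
move=> h j jk; have e : mkseq (Z^~ w) k.+1 = mkseq u k.+1.
  by rewrite -rev_trace /= h revK.
by have := congr1 (fun s => nth (u 0) s j) e; rewrite !nth_mkseq.
Qed.

Hypothesis mZ : forall k, discrete_rv (Z k).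

Lemma measurable_trace k (Q : set (seq Y)) :
  measurable [set w | Q (trace k w)].
Proof.
elim: k Q => [|k ih] Q /=.
  have [q|q] := pselect (Q [::]).
    by rewrite (_ : mkset _ = setT) //; apply/seteqP; split.
  by rewrite (_ : mkset _ = set0) //; apply/seteqP; split.
rewrite (_ : mkset _ = \bigcup_(y in setT)
    (Z k @^-1` [set y] `&` [set w | Q (y :: trace k w)])).
  apply: fin_bigcup_measurable; first exact: finite_finset.
  by move=> y _; apply: measurableI; [exact: mZ|exact: (ih (fun s => Q (y :: s)))].
apply/seteqP; split=> w /=; first by move=> q; exists (Z k w).
by case=> y _ [/= ->].
Qed.

Lemma measurable_history (u : nat -> Y) k : measurable (history Z u k).
Proof.
by rewrite history_trace; exact: (@measurable_trace k.+1 [set s | s = _]).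
Qed.

Context (R : realType) (P : probability T R).

Lemma prob_split k (E : set T) : measurable E ->
  fine (P E) = \sum_y fine (P (E `&` Z k @^-1` [set y])).
Proof.
move=> mE.
have -> : P E = (\sum_y P (E `&` Z k @^-1` [set y]))%E.
  rewrite -[E in LHS]setIT.
  rewrite (_ : [set: T] = \bigcup_(y in [set` enum Y]) Z k @^-1` [set y]); last first.
    by apply/seteqP; split=> w //= _; exists (Z k w); rewrite //= mem_enum.
  rewrite setI_bigcupr measure_fin_bigcup//.
  - by rewrite -fsbig_seq ?enum_uniq// big_enum.
  - by move=> i j _ _ [w [[_ /= <-] [_ /= <-]]].
  - by move=> i _; apply: measurableI => //; exact: mZ.
rewrite -[RHS]/(fine (\sum_y fine (P (E `&` Z k @^-1` [set y])))%:E).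
rewrite -sumEFin; congr fine; apply: eq_bigr => y _.
by rewrite fineK// fin_num_measure//; apply: measurableI => //; exact: mZ.
Qed.

(** Markov's inequality: [h] dominates the indicator of [Q] on words of length k, and the right-hand
    side is the expectation of [h] along the trace. *)
Lemma markov_words k (Q : set (seq Y)) (h : seq Y -> R) :
  (forall s, 0 <= h s) -> (forall s, s \in words k -> Q s -> 1 <= h s) ->
  fine (P [set w | Q (trace k w)]) <=
  \sum_(s <- words k) fine (P [set w | trace k w = s]) * h s.
Proof.
move=> h0 hQ.
(* The event [B] accumulates the constraints on the later coordinates, which the induction strips
   off from the head of the word. *)
suff key (B : set T) : measurable B ->
    fine (P (B `&` [set w | Q (trace k w)])) <=
    \sum_(s <- words k) fine (P (B `&` [set w | trace k w = s])) * h s.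
  by have := key setT measurableT; rewrite setTI; under eq_bigr do rewrite setTI.
elim: k Q h h0 hQ B => [|k ih] Q h h0 hQ B mB /=.
  rewrite big_seq1 (_ : [set w | [::] = [::]] = setT); last first.
    by apply/seteqP; split.
  rewrite setIT; have [q|q] := pselect (Q [::]).
    rewrite (_ : mkset _ = setT) ?setIT; last by apply/seteqP; split.
    by rewrite ler_peMr ?fine_ge0// hQ// inE.
  rewrite (_ : mkset _ = set0) ?setI0 ?measure0; last by apply/seteqP; split.
  by rewrite /= mulr_ge0// fine_ge0.
rewrite (@prob_split k); last first.
  by apply: measurableI => //; exact: (@measurable_trace k.+1).
rewrite big_allpairs_dep/= exchange_big/= big_enum/=.
apply: ler_sum => y _.
pose B' := B `&` Z k @^-1` [set y].
have mB' : measurable B' by apply: measurableI => //; exact: mZ.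
have := ih (fun s => Q (y :: s)) (fun s => h (y :: s)) (fun s => h0 _) _ B' mB'.
set p1 := fine _; set p2 := fine _ => H.
have -> : p2 = p1.
  rewrite /p1 /p2; congr (fine (P _)); apply/seteqP; split=> w /=.
    by move=> [[Bw q] zy]; split; [split|rewrite -zy].
  by move=> [[Bw /= zy] q]; split; [split=> //; rewrite zy|].
apply: le_trans (H _) _.
  by move=> s sk; apply: hQ; apply/allpairsP; exists (s, y); rewrite mem_enum.
apply: ler_sum => s _; rewrite ler_wpM2r//.
suff -> : B' `&` [set w | trace k w = s] =
  B `&` [set w | Z k w :: trace k w = y :: s] by [].
by apply/seteqP; split=> w /=; [move=> [[? /= ->] ->]|move=> [? [? ?]]].
Qed.

End trace.

(** * Joint law of states and dropouts, and decay of the expected product *)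

Section dropout.
Context (d : measure_display) (T : measurableType d) (R : realType).
Context (P : probability T R) (X : finType).
Variables (Q : nat -> X -> X -> R) (Theta : X -> R).
Variables (sp : nat -> T -> X) (gam : nat -> T -> bool).
Hypothesis sp_chain : markov_chain P Q sp.
Hypothesis gam_rv : forall k, discrete_rv (gam k).
Hypothesis gam_law : forall k x, (0 < P [set w | sp k w = x])%E ->
  cprob P [set w | gam k w = false] [set w | sp k w = x] = Theta x.
Hypothesis gam_indep : forall k (path : nat -> X) (g : nat -> bool),
  (0 < P (history sp path k))%E ->
  cprob P (history gam g k) (history sp path k)
    = \prod_(j < k.+1)
        cprob P [set w | gam j w = g j] [set w | sp j w = path j].

Definition jointrv (k : nat) (w : T) : X * bool := (sp k w, gam k w).

Definition drop_law (y : X * bool) : R :=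
  if y.2 then 1 - Theta y.1 else Theta y.1.

Lemma jointrv_discrete k : discrete_rv (jointrv k).
Proof.
move=> [x b].
rewrite (_ : _ @^-1` _ = sp k @^-1` [set x] `&` gam k @^-1` [set b]).
  by apply: measurableI; [exact: sp_chain.1|exact: gam_rv].
by apply/seteqP; split=> w /=; [move=> [-> ->]|move=> [<- <-]].
Qed.

Lemma history_jointrv (u : nat -> X * bool) k :
  history jointrv u k =
  history gam (fun j => (u j).2) k `&` history sp (fun j => (u j).1) k.
Proof.
apply/seteqP; split=> w /=.
  by move=> h; split=> j jk; rewrite -(h j jk).
by move=> [h1 h2] j jk; rewrite /jointrv h1// h2//; case: (u j).
Qed.

Lemma prob_gt0 (A : set T) : fine (P A) != 0 -> (0 < P A)%E.
Proof.
by move=> h; rewrite lt0e measure_ge0 andbT; apply: contraNneq h => ->.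
Qed.

Lemma le_fine_prob (A B : set T) : measurable A -> measurable B ->
  A `<=` B -> fine (P A) <= fine (P B).
Proof.
by move=> mA mB AB; rewrite fine_le ?fin_num_measure// le_measure ?inE.
Qed.

Lemma cprob_gam k (y : X * bool) : (0 < P [set w | sp k w = y.1])%E ->
  cprob P [set w | gam k w = y.2] [set w | sp k w = y.1] = drop_law y.
Proof.
case: y => x [] h; last exact: gam_law.
rewrite /drop_law/= -(gam_law h) /cprob/=.
set B := [set w | sp k w = x].
have mB : measurable B by exact: sp_chain.1.
have Bn0 : fine (P B) != 0.
  by rewrite gt_eqF// fine_gt0// h ltey_eq fin_num_measure.
have -> : fine (P B) = fine (P ([set w | gam k w = true] `&` B)) +
    fine (P ([set w | gam k w = false] `&` B)).
  rewrite (prob_split gam_rv P k mB) big_bool/=.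
  by rewrite ![B `&` _]setIC.
move: Bn0; rewrite (prob_split gam_rv P k mB) big_bool/= ![B `&` _]setIC => Bn0.
by field.
Qed.

(** Conditional independence of the dropouts given the states. A state history of positive
    probability has marginals of positive probability, so each factor is given by [drop_law]; for a
    null history both sides vanish. *)
Lemma prob_history_jointrv (u : nat -> X * bool) k :
  fine (P (history jointrv u k)) =
  fine (P (history sp (fun j => (u j).1) k)) * \prod_(j < k.+1) drop_law (u j).
Proof.
rewrite history_jointrv; set H := history sp _ _; set G := history gam _ _.
have mH : measurable H by apply: measurable_history; exact: sp_chain.1.
have mG : measurable G by exact: measurable_history.
have [H0|Hn0] := eqVneq (fine (P H)) 0.
  rewrite H0 mul0r; apply/eqP; rewrite eq_le fine_ge0// andbT -H0.
  by apply: le_fine_prob => //; exact: measurableI.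
have H0 := prob_gt0 Hn0.
have := gam_indep (fun j => (u j).2) H0; rewrite /cprob -/G -/H.
move=> /(canRL (divfK Hn0)) ->; rewrite mulrC; congr (_ * _).
apply: eq_bigr => j _; apply: cprob_gam.
apply: lt_le_trans H0 _; apply: le_measure; rewrite ?inE//.
  exact: sp_chain.1.
by move=> w; apply; rewrite -ltnS.
Qed.

Lemma prob_history_sp (v : nat -> X) k :
  fine (P (history sp v k.+1)) = fine (P (history sp v k)) * Q k (v k) (v k.+1).
Proof.
have mH i : measurable (history sp v i).
  by apply: measurable_history; exact: sp_chain.1.
have HE : history sp v k.+1 = [set w | sp k.+1 w = v k.+1] `&` history sp v k.
  apply/seteqP; split=> w /=; first by move=> h; split=> [|j jk]; apply: h => //; exact: leqW.
  by move=> [h1 h2] j; rewrite leq_eqVlt => /predU1P[->//|]; exact: h2.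
have [H0|Hn0] := eqVneq (fine (P (history sp v k))) 0.
  rewrite H0 mul0r; apply/eqP; rewrite eq_le fine_ge0// andbT -H0.
  by apply: le_fine_prob => //; rewrite HE; exact: subIsetr.
have := sp_chain.2 k v (prob_gt0 Hn0); rewrite /cprob -HE.
by move=> /(canRL (divfK Hn0)) ->; rewrite mulrC.
Qed.

Lemma prob_history_step (u : nat -> X * bool) k :
  fine (P (history jointrv u k.+1)) = fine (P (history jointrv u k)) *
    (Q k (u k).1 (u k.+1).1 * drop_law (u k.+1)).
Proof.
by rewrite !prob_history_jointrv prob_history_sp big_ord_recr/= mulrACA mulrA.
Qed.

(** The pair of state and dropout is a Markov chain whose kernel ignores the previous dropout. *)
Lemma prob_trace_step k (y y' : X * bool) s : size s = k ->
  fine (P [set w | trace jointrv k.+2 w = y' :: y :: s]) =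
  fine (P [set w | trace jointrv k.+1 w = y :: s]) *
    (Q k y.1 y'.1 * drop_law y').
Proof.
move=> sk; pose u := nth y (rev (y' :: y :: s)).
have uS : u k.+1 = y' by rewrite /u nth_rev/= sk// subnn.
have uk : u k = y by rewrite /u nth_rev/= sk// subSnn.
have E1 : rev (mkseq u k.+2) = y' :: y :: s.
  rewrite -[RHS]revK; congr rev; rewrite /u.
  by rewrite (_ : k.+2 = size (rev (y' :: y :: s))) ?mkseq_nth// size_rev/= sk.
have E0 : rev (mkseq u k.+1) = y :: s.
  by move: E1; rewrite mkseqS rev_rcons => -[].
by rewrite -E1 -E0 -!history_trace prob_history_step uS uk.
Qed.

Variable c : bool -> R.
Hypothesis c_ge0 : forall b, 0 <= c b.

Definition weight (s : seq (X * bool)) : R := \prod_(y <- s) c y.2.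

(* [exp_weight k] is the expectation of [\prod_(j < k) c (gam j)]. *)
Definition exp_weight (k : nat) : R :=
  \sum_(s <- words (X * bool)%type k)
    fine (P [set w | trace jointrv k w = s]) * weight s.

Lemma weight_ge0 s : 0 <= weight s.
Proof. by apply: prodr_ge0. Qed.

Lemma exp_weight_ge0 k : 0 <= exp_weight k.
Proof. by apply: sumr_ge0 => s _; rewrite mulr_ge0 ?weight_ge0 ?fine_ge0. Qed.

Variable eta : R.
Hypothesis contraction : forall k x,
  \sum_x' Q k x x' * ((1 - Theta x') * c true + Theta x' * c false) <= eta.

(** Conditioning on the history up to time k bounds the mean of the factor of time k + 1. The factor
    of time 0 is not covered, since the initial law is arbitrary; hence the shift of the index. *)
Lemma exp_weight_step k : exp_weight k.+2 <= eta * exp_weight k.+1.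
Proof.
rewrite {1}/exp_weight [words _ k.+2]/= big_allpairs_dep/= -/(words _ k.+1).
rewrite mulr_sumr big_seq [leRHS]big_seq; apply: ler_sum => s.
(* The word is nonempty; its head [y] is the value at time k, on which alone the next step
   depends. *)
case: s => [|y s] /size_words //= [sk].
rewrite big_enum /=.
under eq_bigr => y' _.
  rewrite prob_trace_step// /weight big_cons -/(weight _).
  rewrite [X in _ * X]mulrC mulrACA; over.
rewrite -mulr_sumr mulrC; apply: ler_wpM2r.
  by rewrite mulr_ge0 ?weight_ge0 ?fine_ge0.
apply: le_trans (contraction k y.1).
rewrite -(pair_bigA _ (fun x' b => Q k y.1 x' * drop_law (x', b) * c b))/=.
apply: ler_sum => x' _; rewrite big_bool /drop_law/=.
by rewrite -!mulrA -mulrDr.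
Qed.

Lemma exp_weight_geometric : 0 < eta ->
  {D : R | 0 < D & forall k, exp_weight k <= D * eta ^+ k}.
Proof.
(* The first two terms cover k = 0 and k >= 1; the last makes the constant positive. *)
move=> eta0; exists (exp_weight 0 + exp_weight 1 / eta + 1).
  by rewrite ltr_wpDl// addr_ge0 ?divr_ge0 ?exp_weight_ge0// ltW.
have e0 := exp_weight_ge0 0; have e1 := exp_weight_ge0 1.
have ek k : 0 <= eta ^+ k by rewrite exprn_ge0// ltW.
have e2 : 0 <= exp_weight 1 / eta by rewrite divr_ge0// ltW.
case=> [|k]; first by rewrite expr0 mulr1; lra.
have H : exp_weight k.+1 <= exp_weight 1 * eta ^+ k.
  elim: k => [|k ih]; first by rewrite expr0 mulr1.
  apply: le_trans (exp_weight_step k) _.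
  by rewrite exprS mulrCA ler_wpM2l// ltW.
apply: le_trans H _.
have -> : exp_weight 1 * eta ^+ k = exp_weight 1 / eta * eta ^+ k.+1.
  by rewrite exprS mulrA divfK// gt_eqF.
by rewrite ler_wpM2r//; lra.
Qed.

Lemma markov_trace k (q : set (seq (X * bool))) (a b : R) : 0 < b -> 0 <= a ->
  (forall s, s \in words _ k -> q s -> b <= a * weight s) ->
  fine (P [set w | q (trace jointrv k w)]) <= a / b * exp_weight k.
Proof.
move=> b0 a0 H; rewrite mulr_sumr.
under eq_bigr do rewrite mulrCA.
apply: (markov_words jointrv_discrete).
  by move=> s; rewrite mulr_ge0 ?weight_ge0// divr_ge0// ltW.
by move=> s sk qs; rewrite mulrAC ler_pdivlMr// mul1r H.
Qed.

End dropout.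

(** * Tail suprema of a process driven causally by the dropouts *)

Section tail.
Context (d : measure_display) (T : measurableType d) (R : realType).
Context (P : probability T R) (X : finType).
Variables (Q : nat -> X -> X -> R) (sp : nat -> T -> X) (gam : nat -> T -> bool).
Hypothesis sp_chain : markov_chain P Q sp.
Hypothesis gam_rv : forall k, discrete_rv (gam k).

Variable x : (nat -> bool) -> nat -> R.
Hypothesis x_causal : forall g g' k,
  (forall j, (j < k)%N -> g j = g' j) -> x g k = x g' k.

(** Recovers the dropout sequence from a trace, in order of time; the default value past the end is
    harmless because [x] is causal. *)
Definition drops (s : seq (X * bool)) : nat -> bool :=
  nth true (map snd (rev s)).

Lemma drops_trace k w j : (j < k)%N ->
  drops (trace (jointrv sp gam) k w) j = gam j w.
Proof.
move=> jk; rewrite /drops rev_trace -map_comp.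
by rewrite (nth_mkseq true (fun j => gam j w)).
Qed.

Lemma event_trace k (B : set R) : [set w | B (x (gam^~ w) k)] =
  [set w | B (x (drops (trace (jointrv sp gam) k w)) k)].
Proof.
apply/seteqP; split=> w /=.
  by rewrite (@x_causal _ (gam^~ w))// => j jk; rewrite drops_trace.
by rewrite (@x_causal _ (gam^~ w))// => j jk; rewrite drops_trace.
Qed.

Lemma measurable_event k (B : set R) : measurable [set w | B (x (gam^~ w) k)].
Proof.
rewrite event_trace.
exact: (@measurable_trace _ _ _ _ (jointrv_discrete sp_chain gam_rv) k
  (fun s => B (x (drops s) k))).
Qed.

Lemma measurable_fun_process k :
  measurable_fun setT (fun w => (x (gam^~ w) k)%:E).
Proof.
move=> _ B mB; rewrite setTI.
exact: (@measurable_event k [set y | B y%:E]).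
Qed.

Lemma measurable_tail_sup (r : R) k :
  measurable [set w | (r%:E <= esups (fun k => (x (gam^~ w) k)%:E) k)%E].
Proof.
have := measurable_fun_esups measurable_fun_process k.
move=> /(_ measurableT _ (emeasurable_itv `[r%:E, +oo[)).
rewrite setTI; congr measurable; apply/seteqP; split=> w /=.
  by rewrite in_itv/= andbT.
by rewrite in_itv/= andbT.
Qed.

Lemma measurable_lim_tail_sup (r : R) :
  measurable [set w | (r%:E <= limn (esups (fun k => (x (gam^~ w) k)%:E)))%E].
Proof.
have := measurable_fun_limn_esup measurable_fun_process.
move=> /(_ measurableT _ (emeasurable_itv `[r%:E, +oo[)).
rewrite setTI; congr measurable; apply/seteqP; split=> w /=.
  by rewrite in_itv/= andbT limn_esup_lim.
by rewrite in_itv/= andbT limn_esup_lim.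
Qed.

Lemma weight_drops (c : bool -> R) k (s : seq (X * bool)) : s \in words _ k ->
  weight c s = \prod_(j < k) c (drops s j).
Proof.
move=> /size_words sk; rewrite /weight.
transitivity (\prod_(b <- map snd (rev s)) c b).
  by rewrite big_map -(perm_big _ (permEl (perm_rev s))).
by rewrite (big_nth true) big_mkord size_map size_rev sk.
Qed.

Lemma sum_geometric_le (q : R) k : 0 <= q < 1 ->
  \sum_(i < k) q ^+ i <= (1 - q)^-1.
Proof.
move=> /andP[q0 q1]; rewrite -[leRHS]mul1r ler_pdivlMr ?subr_gt0// mulrC.
have -> : (1 - q) * (\sum_(i < k) q ^+ i) = 1 - q ^+ k.
  by rewrite -opprB mulNr -subrX1 opprB.
by rewrite lerBlDr lerDl exprn_ge0.
Qed.

(** Union bound over the times k' + i, each term estimated by [markov_trace]. The threshold is r / 2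
    because a supremum of at least r need not be attained at level r. *)
Lemma tail_prob_le (c : bool -> R) (D eta a b r : R) k' :
  (forall i, 0 <= c i) -> 0 < D -> 0 < eta < 1 -> 0 <= a -> 0 < b -> 0 < r ->
  (forall k, exp_weight P sp gam c k <= D * eta ^+ k) ->
  (forall g k, r / 2 <= x g k -> b <= a * \prod_(j < k) c (g j)) ->
  (P [set w | r%:E <= esups (fun k => (x (gam^~ w) k)%:E) k'] <=
   (a / b * D / (1 - eta) * eta ^+ k')%:E)%E.
Proof.
move=> c0 D0 /andP[eta0 eta1] a0 b0 r0 expw large.
pose E i := [set w | r / 2 <= x (gam^~ w) (k' + i)].
have mE i : measurable (E i) by exact: (@measurable_event _ [set y | r / 2 <= y]).
have PE i : (P (E i) <= (a / b * D * eta ^+ k' * eta ^+ i)%:E)%E.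
  rewrite -[P _]fineK ?fin_num_measure// lee_fin /E (@event_trace _ [set y | r / 2 <= y]).
  apply: (@le_trans _ _ (a / b * exp_weight P sp gam c (k' + i))).
    apply: (@markov_trace _ _ _ _ _ _ _ _ sp_chain gam_rv c c0 _
      [set s | r / 2 <= x (drops s) (k' + i)]) => // s sk /= /large.
    by rewrite (weight_drops _ sk).
  rewrite -!mulrA -exprD; apply: ler_wpM2l => //.
  by rewrite ler_wpM2l ?invr_ge0// ltW.
have sub : [set w | r%:E <= esups (fun k => (x (gam^~ w) k)%:E) k']%E
    `<=` \bigcup_i E i.
  move=> w /=; apply: contraPP => nE; apply/negP; rewrite -ltNge.
  apply: (@le_lt_trans _ _ (r / 2)%:E); last by rewrite lte_fin; lra.
  apply: ge_ereal_sup => _ [k /= kk <-]; rewrite lee_fin leNgt; apply/negP => h.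
  by apply: nE; exists (k - k')%N => //=; rewrite /E/= subnKC// ltW.
apply: le_trans (measure_sigma_subadditive P mE (measurable_tail_sup r k') sub) _.
apply: lime_le; first exact: is_cvg_nneseries.
apply: nearW => m /=.
apply: le_trans (lee_sum _ (fun i _ => PE i)) _.
rewrite sumEFin lee_fin -mulr_sumr big_mkord.
rewrite (_ : a / b * D / (1 - eta) * eta ^+ k' =
  a / b * D * eta ^+ k' * (1 - eta)^-1); last by rewrite mulrAC.
apply: ler_wpM2l; last by rewrite sum_geometric_le// ltW.
by rewrite !mulr_ge0 ?invr_ge0 ?exprn_ge0// ltW.
Qed.

(** The limit of the tail suprema is their infimum, so the limit event lies in every tail event, and
    the probabilities of these tend to 0. *)
Lemma lim_tail_null (kap eta r : R) : 0 <= eta < 1 ->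
  (forall k', (P [set w | r%:E <= esups (fun k => (x (gam^~ w) k)%:E) k'] <=
     (kap * eta ^+ k')%:E)%E) ->
  P [set w | (r%:E <= limn (esups (fun k => (x (gam^~ w) k)%:E)))%E] = 0%E.
Proof.
move=> /andP[eta0 eta1] H; set L := [set w | _].
have mL : measurable L by exact: measurable_lim_tail_sup.
have PL k' : fine (P L) <= kap * eta ^+ k'.
  rewrite -lee_fin fineK ?fin_num_measure//; apply: le_trans (H k').
  apply: le_measure; rewrite ?inE//; first exact: measurable_tail_sup.
  move=> w /= /le_trans; apply.
  rewrite (cvg_lim _ (@cvg_esups_inf _ _))//.
  by apply: ereal_inf_lbound; exists k'.
suff L0 : fine (P L) <= 0.
  by rewrite -[P L]fineK ?fin_num_measure//; congr EFin;
     apply/eqP; rewrite eq_le L0 fine_ge0.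
have cv : geometric kap eta @ \oo --> (0 : R).
  by apply: cvg_geometric; rewrite ger0_norm.
rewrite -(cvg_lim _ cv)//; apply: limr_ge.
  by apply/cvg_ex; exists 0.
by apply: nearW => k'; exact: PL.
Qed.

End tail.


(** * Comparison functions *)

Section comparison.
Context (R : realType).
Implicit Types (a : R -> R) (s t : R).

Lemma classK_ge0 a s : classK a -> 0 <= s -> 0 <= a s.
Proof.
move=> [_ mono a0]; rewrite le_eqVlt => /predU1P[<-|s0]; first by rewrite a0.
by rewrite -a0 ltW// mono.
Qed.

Lemma classK_gt0 a s : classK a -> 0 < s -> 0 < a s.
Proof. by move=> [_ mono a0] s0; rewrite -a0 mono. Qed.

Lemma classK_le a s t : classK a -> 0 <= s -> s <= t -> a s <= a t.
Proof.
by move=> [_ mono a0] s0; rewrite le_eqVlt => /predU1P[->//|st]; rewrite ltW// mono.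
Qed.

Lemma classKoo_scale (c : R) a : 0 < c -> classKoo a ->
  classKoo (fun s => c * a s).
Proof.
move=> c0 [[cont mono a0] aoo]; split; first split.
- by move=> s; apply: cvgM; [exact: cvg_cst|exact: cont].
- by move=> s t s0 st; rewrite ltr_pM2l// mono.
- by rewrite a0 mulr0.
- exact: gt0_cvgMry.
Qed.

Lemma classKoo_sqrt a : classKoo a -> classKoo (fun s => Num.sqrt (a s)).
Proof.
move=> [aK aoo]; have [cont mono a0] := aK; split; first split.
- by move=> s; apply: cvg_comp (cont s) (@sqrt_continuous _ (a s)).
- move=> s t s0 st; rewrite ltr_sqrt ?mono//.
  by apply: (classK_gt0 aK); apply: le_lt_trans st.
- by rewrite a0 sqrtr0.
- apply/cvgryPge => A; have /cvgryPge/(_ (A ^+ 2)) := aoo.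
  apply: filterS => s As; rewrite (le_trans (ler_norm A))//.
  by rewrite -sqrtr_sqr ler_wsqrtr.
Qed.

Lemma classK_small a (e : R) : classK a -> 0 < e ->
  exists2 r' : R, 0 < r' & forall s, 0 <= s -> s < r' -> a s <= e.
Proof.
move=> [cont mono a0] e0.
have /continuous_within_itvcyP[_ ca] := cont.
have /cvgr_le/(_ e) := ca; rewrite a0 => /(_ e0).
case => /= dl dl0 H.
exists dl => // s; rewrite le_eqVlt => /predU1P[<- _|s0 sd]; first by rewrite a0 ltW.
by apply: H => //=; rewrite sub0r normrN gtr0_norm.
Qed.

(** The factor c / (1 + t) is positive for t >= 0, which keeps class K-infinity in s, and tends to
    0. *)
Lemma classKL_scaled_inverse a (c : R) : classKoo a -> 0 < c ->
  classKL (fun s t => a s * (c / (1 + t))).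
Proof.
move=> aK c0; split=> [t t0|s s0].
  have := @classKoo_scale (c / (1 + t)) a; rewrite divr_gt0//; last lra.
  by move=> /(_ isT aK); under eq_fun do rewrite mulrC.
rewrite -[X in _ --> X](mulr0 (a s)); apply: cvgM; first exact: cvg_cst.
rewrite -[X in _ --> X](mulr0 c); apply: cvgM; first exact: cvg_cst.
apply/gtr0_cvgV0.
  near=> t; have : 0 < t by near: t; apply: nbhs_pinfty_gt; rewrite num_real.
  by move=> t0; rewrite addr_gt0.
apply/cvgryPge => A; near=> t.
have : A <= t by near: t; apply: nbhs_pinfty_ge; rewrite num_real.
by lra.
Unshelve. all: by end_near. Qed.

End comparison.

(** * Uniform contraction of square roots *)

Section concavity.
Context (R : realType).

(* If [1 < b], the bound [eta] is the value at the largest [q] allowed by the *)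
(* constraint; otherwise it is the value at [q = t].                          *)
Lemma sqrt_contraction (a b t : R) : 0 < a -> a < 1 -> a < b -> 0 <= t < 1 ->
  exists2 eta : R, 0 < eta < 1 &
    forall q, q <= t -> a ^+ 2 + (b ^+ 2 - a ^+ 2) * q <= 1 ->
      a + (b - a) * q <= eta.
Proof.
move=> a0 a1 ab /andP[t0 t1]; have [b1|b1] := leP b 1.
  exists (a + (b - a) * t); last by move=> q qt _; nra.
  by apply/andP; split; nra.
have s0 : 0 < a + b by lra.
exists ((1 + a * b) / (a + b)).
  rewrite divr_gt0//=; last by nra.
  (* The difference (a + b) - (1 + a b) equals (1 - a)(b - 1), which is positive. *)
  by rewrite ltr_pdivrMr//; nra.
(* Multiplied by a + b, the claim is the constraint with a b added to both sides. *)
by move=> q _ H; rewrite ler_pdivlMr//; nra.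
Qed.

End concavity.

(** * Pathwise Lyapunov estimate for the closed loop *)

Section ncs.
Context (R : realType) (n l m : nat).
Variable f : 'cV[R]_n -> 'cV[R]_l -> 'cV[R]_m -> 'cV[R]_n.
Variable K : 'cV[R]_n -> 'cV[R]_l.

Lemma norm_usubmx (z : 'cV[R]_(n + n)) : `|usubmx z| <= `|z|.
Proof.
rewrite /Num.norm/= !mx_normrE; apply: bigmax_le => [|ij _].
  by rewrite bigmax_idl le_max lexx.
rewrite mxE; exact: (le_bigmax _ (fun ij => `|z ij.1 ij.2|) (lshift n ij.1, ij.2)).
Qed.

Lemma norm_col_mx0 (x : 'cV[R]_n) : `|col_mx x (0 : 'cV[R]_n)| <= `|x|.
Proof.
have x0 : 0 <= `|x| by [].
move: x0; rewrite /Num.norm/= !mx_normrE => x0; apply: bigmax_le => // -[i j] _ /=.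
rewrite mxE; case: splitP => i' _; last by rewrite mxE normr0.
exact: (le_bigmax _ (fun ij => `|x ij.1 ij.2|) (i', j)).
Qed.

Lemma ncs_z_causal g g' w x0 k : (forall j, (j < k)%N -> g j = g' j) ->
  ncs_z f K g w x0 k = ncs_z f K g' w x0 k.
Proof.
elim: k => //= k ih gg; rewrite gg// ih// => j jk; apply: gg; exact: leqW.
Qed.

Context (V : bool -> 'cV[R]_(n + n) -> R) (alpha1 alpha2 chi : R -> R).
Context (rho : R) (lam : bool -> R).
Hypotheses (alpha1K : classK alpha1) (alpha2K : classK alpha2).
Hypothesis chiK : classK chi.
Hypotheses (rho0 : 0 < rho) (lam0 : forall i, 0 < lam i).
Hypothesis hV : multiple_lyapunov (switched f K) V alpha1 alpha2 chi rho lam.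

Lemma lyapunov_ge0 i y : 0 <= V i y.
Proof.
have [/(_ i y)/andP[h _] _ _ _] := hV.
by apply: le_trans h; exact: classK_ge0.
Qed.

(* For [i = j] this is not an assumption: exchanging the indices twice gives *)
(* [V i y <= rho ^+ 2 * V i y], so that [V i y = 0] or [1 <= rho].            *)
Lemma lyapunov_exchange i j y : V i y <= rho * V j y.
Proof.
have [_ _ h _] := hV; have [<-|ij] := eqVneq i j; last exact: h.
have ni : i != ~~ i by case: (i).
have ni' : ~~ i != i by case: (i).
have := h _ _ y ni; have := h _ _ y ni'; have := lyapunov_ge0 i y.
move: (V i y) (V (~~ i) y) => u v u0 vu uv.
have [r1|r1] := leP 1 rho; first by rewrite ler_peMl.
have uu : u <= rho * (rho * u) by apply: le_trans uv _; rewrite ler_wpM2l// ltW.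
have ru : rho * (rho * u) <= rho * u.
  by apply: ler_wpM2l; [exact: ltW|apply: ler_piMl => //; exact: ltW].
exact: le_trans uu ru.
Qed.

(** Each step costs one [rho], to exchange the index for that of the mode [g k] that acts, and one
    [lam (g k)], from the decrease condition of this mode. *)
Lemma lyapunov_bound g x0 k i :
  V i (ncs_z f K g (fun _ => 0) x0 k) <=
  rho * alpha2 `|x0| * \prod_(j < k) (rho * lam (g j)).
Proof.
have [bnd dec _ _] := hV.
elim: k i => [|k ih] i /=.
  rewrite big_ord0 mulr1; apply: le_trans (lyapunov_exchange i i _) _.
  apply: ler_wpM2l; first exact: ltW.
  have /andP[_ h] := bnd i (col_mx x0 0).
  apply: le_trans h _; apply: classK_le => //; exact: norm_col_mx0.
apply: le_trans (lyapunov_exchange _ (g k) _) _.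
rewrite big_ord_recr/= mulrA [leRHS]mulrC -[leRHS]mulrA.
apply: ler_wpM2l; first exact: ltW.
have := dec (g k) (ncs_z f K g (fun _ => 0) x0 k) 0.
have [_ _ chi0] := chiK; rewrite normr0 chi0 addr0 => /le_trans; apply.
by apply: ler_wpM2l; [exact: ltW|exact: ih].
Qed.

Lemma ncs_x_bound g x0 k (s : R) : 0 <= s ->
  s <= `|ncs_x f K g (fun _ => 0) x0 k| ->
  alpha1 s <= rho * alpha2 `|x0| * \prod_(j < k) (rho * lam (g j)).
Proof.
move=> s0 /le_trans/(_ (norm_usubmx _)) sz.
have [bnd _ _ _] := hV.
apply: le_trans (lyapunov_bound g x0 k true).
have /andP[h _] := bnd true (ncs_z f K g (fun _ => 0) x0 k).
by apply: le_trans h; exact: classK_le.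
Qed.

End ncs.

(** * From contraction of the weights to safety *)

Section safety_transfer.
Context (d : measure_display) (T : measurableType d) (R : realType).
Context (P : probability T R) (n : nat).

(** Bounding eta^k' by 1 leaves a class K-infinity function of |x_0| alone, so the radius r' does
    not depend on k'. *)
Lemma ASES_ASAS (X : 'cV[R]_n -> nat -> T -> 'cV[R]_n) (eta r : R) :
  0 <= eta < 1 -> 0 < r -> ASES P X eta ->
  (forall x0, P [set w | (r%:E <= limn (tail_sup X x0 w))%E] = 0%E) ->
  ASAS P X r.
Proof.
move=> /andP[eta0 eta1] r0 [kappa [alpha [alphaK]]] /(_ r r0) [kap0 tail] lim0.
move=> eps /andP[eps0 _].
pose g s := kappa r * alpha s.
have gK : classKoo g by exact: classKoo_scale.
have [r' r'0 small] := classK_small gK.1 eps0.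
exists r' => // k' k'0.
pose c : R := (1 + k'%:R) * (1 + r).
have k1 : 0 < 1 + k'%:R :> R by rewrite addr_gt0// ltr0n.
have r1 : 0 < 1 + r by rewrite addr_gt0.
have c0 : 0 < c by rewrite mulr_gt0.
(* As [xi] is chosen after k' and r, [c] can be normalized so that the decaying factors cancel at
   (k', r). *)
pose xi s t u := g s * (c / (1 + u) / (1 + t)).
have xiE s : xi s k'%:R r = g s by rewrite /xi /c; field; rewrite !gt_eqF.
exists xi.
  move=> u u0; have cu0 : 0 < c / (1 + u) by rewrite divr_gt0// ltr_wpDr.
  split; first exact: classKL_scaled_inverse.
  rewrite (_ : (fun s t => xi s u t) = fun s t => g s * (c / (1 + u) / (1 + t))).
    exact: classKL_scaled_inverse.
  by apply/funext => s; apply/funext => t; rewrite /xi; congr (_ * _); rewrite mulrAC.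
move=> x0 x0r'; rewrite xiE; split=> //; last exact: small.
apply: le_trans (tail x0 k') _; rewrite lee_fin /g -mulrA.
apply: ler_wpM2l; first exact: ltW.
rewrite ler_piMl ?(classK_ge0 alphaK.1)//.
by rewrite exprn_ile1// ltW.
Qed.

Context (X : finType) (Q : nat -> X -> X -> R) (Theta : X -> R).
Context (sp : nat -> T -> X) (gam : nat -> T -> bool).
Hypothesis sp_chain : markov_chain P Q sp.
Hypothesis gam_rv : forall k, discrete_rv (gam k).
Hypothesis gam_law : forall k x, (0 < P [set w | sp k w = x])%E ->
  cprob P [set w | gam k w = false] [set w | sp k w = x] = Theta x.
Hypothesis gam_indep : forall k (path : nat -> X) (g : nat -> bool),
  (0 < P (history sp path k))%E ->
  cprob P (history gam g k) (history sp path k)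
    = \prod_(j < k.+1)
        cprob P [set w | gam j w = g j] [set w | sp j w = path j].
Variable x : 'cV[R]_n -> (nat -> bool) -> nat -> 'cV[R]_n.
Hypothesis x_causal : forall x0 g g' k,
  (forall j, (j < k)%N -> g j = g' j) -> x x0 g k = x x0 g' k.
Variables (c : bool -> R) (eta : R) (alpha b : R -> R).
Hypotheses (c_ge0 : forall i, 0 <= c i) (eta01 : 0 < eta < 1).
Hypothesis contraction : forall k y,
  \sum_y' Q k y y' * ((1 - Theta y') * c true + Theta y' * c false) <= eta.
Hypotheses (alphaK : classKoo alpha) (b_gt0 : forall s, 0 < s -> 0 < b s).
Hypothesis x_bound : forall x0 g k s, 0 < s -> s <= `|x x0 g k| ->
  b s <= alpha `|x0| * \prod_(j < k) c (g j).

Lemma contraction_safety :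
  let Y := fun x0 k w => x x0 (fun j => gam j w) k in
  ASES P Y eta /\
  forall r x0, 0 < r -> P [set w | (r%:E <= limn (tail_sup Y x0 w))%E] = 0%E.
Proof.
move=> Y; have /andP[eta0 eta1] := eta01.
have [D D0 expw] := exp_weight_geometric sp_chain gam_rv gam_law gam_indep
  c_ge0 contraction eta0.
have norm_causal x0 g g' k : (forall j, (j < k)%N -> g j = g' j) ->
    `|x x0 g k| = `|x x0 g' k|.
  by move=> gg; rewrite (x_causal x0 gg).
pose kappa r := D / (b (r / 2) * (1 - eta)).
have tail r x0 k' : 0 < r -> (P [set w | r%:E <= tail_sup Y x0 w k']
    <= (kappa r * alpha `|x0| * eta ^+ k')%:E)%E.
  move=> r0; have r20 : 0 < r / 2 by rewrite divr_gt0.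
  have -> : kappa r * alpha `|x0| = alpha `|x0| / b (r / 2) * D / (1 - eta).
    by rewrite /kappa invfM -!mulrA [RHS]mulrC !mulrA; congr (_ * _); ring.
  apply: (@tail_prob_le _ _ _ _ _ _ _ _ sp_chain gam_rv
    (fun g k => `|x x0 g k|) (norm_causal x0) c) => //.
  - exact: (classK_ge0 alphaK.1).
  - exact: b_gt0.
  - by move=> g k; exact: x_bound.
split.
  exists kappa, alpha; split=> // r r0; split=> [|x0 k'].
    by rewrite divr_gt0// mulr_gt0 ?subr_gt0// b_gt0// divr_gt0.
  by rewrite mulrAC; exact: tail.
move=> r x0 r0.
apply: (@lim_tail_null _ _ _ _ _ _ _ _ sp_chain gam_rv
    (fun g k => `|x x0 g k|) (norm_causal x0) (kappa r * alpha `|x0|) eta).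
  by rewrite ltW.
by move=> k'; exact: tail.
Qed.

End safety_transfer.

(** * The joint chain and its one-step drop probability *)

Section joint_chain.
Context (R : realType) (N : nat) (A : finType) (M : mdp R N A).
Context (Omegap : {fset R}) (mu : policy M Omegap).
Variable theta : 'I_N -> Omegap -> R.

Lemma joint_trans_ge0 k sp sp' : 0 <= joint_trans mu k sp sp'.
Proof.
rewrite /joint_trans mulr_ge0 ?(pow_rule_distr mu k sp.1).1//.
apply: sumr_ge0 => a aM.
by rewrite mulr_ge0 ?(trans_distr aM).1 ?(act_rule_distr mu k sp.1).1.
Qed.

Lemma joint_trans_sum1 k sp : \sum_sp' joint_trans mu k sp sp' = 1.
Proof.
rewrite -(pair_bigA _ (fun s' p' => joint_trans mu k sp (s', p')))/=.
rewrite /joint_trans/=; under eq_bigr do rewrite -mulr_suml.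
rewrite -mulr_sumr (pow_rule_distr mu k sp.1).2 mul1r exchange_big/=.
under eq_bigr => a aM do rewrite -mulr_suml (trans_distr aM).2 mul1r.
(* The kernel sums over available actions only; the decision rule gives the others mass 0. *)
rewrite -[RHS](act_rule_distr mu k sp.1).2 [RHS](bigID (mem (avail M sp.1)))/=.
rewrite [X in _ = _ + X]big1 ?addr0// => a aM.
exact: act_rule_avail.
Qed.

(** Probability that the packet of time k + 1 is lost, given the joint state [sp] at time k. *)
Definition drop_prob k (sp : 'I_N * Omegap) : R :=
  \sum_sp' joint_trans mu k sp sp' * theta sp'.1 sp'.2.

Lemma drop_probE k s p :
  \sum_(s' : 'I_N) \sum_(p' : Omegap) theta s' p' * pow_rule mu k s p' *
    (\sum_(a in avail M s) trans M s a s' * act_rule mu k s a)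
  = drop_prob k (s, p).
Proof.
rewrite pair_bigA/=; apply: eq_bigr => -[s' p'] _ /=.
by rewrite /joint_trans/= -mulrA mulrC.
Qed.

Lemma mean_weight k sp (c : bool -> R) :
  \sum_sp' joint_trans mu k sp sp' *
    ((1 - theta sp'.1 sp'.2) * c true + theta sp'.1 sp'.2 * c false)
  = c true + (c false - c true) * drop_prob k sp.
Proof.
transitivity (c true * (\sum_sp' joint_trans mu k sp sp') +
    (c false - c true) * drop_prob k sp); last by rewrite joint_trans_sum1 mulr1.
rewrite !mulr_sumr -big_split/=.
by apply: eq_bigr => sp' _; ring.
Qed.

Hypothesis theta01 : forall i p, 0 <= theta i p < 1.

Lemma drop_prob_ge0 k sp : 0 <= drop_prob k sp.
Proof.
apply: sumr_ge0 => sp' _; rewrite mulr_ge0 ?joint_trans_ge0//.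
by have /andP[] := theta01 sp'.1 sp'.2.
Qed.

(** Every drop probability is an average of values of [theta], hence at most their maximum over a
    finite set, whatever the time and the policy. *)
Lemma drop_prob_uniform : exists2 t : R, 0 <= t < 1 &
  forall k sp, drop_prob k sp <= t.
Proof.
exists (\big[Num.max/0]_(sp : 'I_N * Omegap) theta sp.1 sp.2).
  apply/andP; split; first by rewrite bigmax_idl le_max lexx.
  by apply: bigmax_lt => // sp _; have /andP[] := theta01 sp.1 sp.2.
move=> k sp; rewrite -[leRHS]mul1r -(joint_trans_sum1 k sp) mulr_suml.
apply: ler_sum => sp' _; rewrite ler_wpM2l ?joint_trans_ge0//.
exact: (le_bigmax _ (fun sp : 'I_N * Omegap => theta sp.1 sp.2)).
Qed.

End joint_chain.

(** * Choice of the weights: square roots in (i), [rho * lam] in (ii) *)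

Theorem theoremV5 (R : realType) (n l m : nat)
  (f : 'cV[R]_n -> 'cV[R]_l -> 'cV[R]_m -> 'cV[R]_n)
  (K : 'cV[R]_n -> 'cV[R]_l)
  (N : nat) (A : finType) (M : mdp R N A)
  (Omegap : {fset R}) (mu : policy M Omegap)
  (theta : 'I_N -> Omegap -> R)
  (d : measure_display) (T : measurableType d) (P : probability T R)
  (sp : nat -> T -> 'I_N * Omegap) (gam : nat -> T -> bool)
  (hchain : markov_chain P (joint_trans mu) sp)
  (hsddc : sddc P theta sp gam)
  (V : bool -> 'cV[R]_(n + n) -> R)
  (alpha1 alpha2 chi : R -> R) (rho : R) (lam : bool -> R)
  (halpha1 : classKoo alpha1) (halpha2 : classKoo alpha2) (hchi : classK chi)
  (hrho : 0 < rho) (hlam : forall i, 0 < lam i)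
  (hlam01 : lam true < lam false) (hrholam : rho * lam true < 1)
  (hV : multiple_lyapunov (switched f K) V alpha1 alpha2 chi rho lam) :
  let X := fun (x0 : 'cV[R]_n) (k : nat) (w : T) =>
    ncs_x f K (fun j => gam j w) (fun _ => 0) x0 k in
  ((forall (k : nat) (s : 'I_N) (p : Omegap),
      \sum_(s' : 'I_N) \sum_(p' : Omegap)
        theta s' p' * pow_rule mu k s p' *
        (\sum_(a in avail M s) trans M s a s' * act_rule mu k s a)
      < (1 - lam true * rho) / (rho * (lam false - lam true))) ->
   forall r : R, 0 < r -> ASAS P X r)
  /\
  (forall eta : R, 0 <= eta < 1 ->
   (forall (k : nat) (s : 'I_N) (p : Omegap),
      \sum_(s' : 'I_N) \sum_(p' : Omegap)
        theta s' p' * pow_rule mu k s p' *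
        (\sum_(a in avail M s) trans M s a s' * act_rule mu k s a)
      < (eta - lam true * rho) / (rho * (lam false - lam true))) ->
   ASES P X eta).
Proof.
have [theta01 _ gam_rv gam_law gam_indep] := hsddc.
have law k x : (0 < P [set w | sp k w = x])%E ->
    cprob P [set w | gam k w = false] [set w | sp k w = x] = theta x.1 x.2.
  by case: x => i p; exact: gam_law.
have lt01 : 0 < lam false - lam true by rewrite subr_gt0.
have den0 : 0 < rho * (lam false - lam true) by rewrite mulr_gt0.
have causal (x0 : 'cV[R]_n) g g' k : (forall j, (j < k)%N -> g j = g' j) ->
    ncs_x f K g (fun _ => 0) x0 k = ncs_x f K g' (fun _ => 0) x0 k.
  by move=> gg; rewrite /ncs_x (ncs_z_causal f K _ x0 gg).
have bound := ncs_x_bound halpha1.1 halpha2.1 hchi hrho hlam hV.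
have rl0 i : 0 < rho * lam i by rewrite mulr_gt0.
move=> X; split=> [drop r r0|eta /andP[eta0 eta1] drop].
  have [t t01 qt] := drop_prob_uniform mu theta01.
  pose c i := Num.sqrt (rho * lam i).
  have ct0 : 0 < c true by rewrite sqrtr_gt0.
  have ct1 : c true < 1 by rewrite -[ltRHS]sqrtr1 ltr_sqrt.
  have ctf : c true < c false by rewrite ltr_sqrt// ltr_pM2l.
  have [eta eta01 contr] := sqrt_contraction ct0 ct1 ctf t01.
  have contraction k y : \sum_y' joint_trans mu k y y' *
      ((1 - theta y'.1 y'.2) * c true + theta y'.1 y'.2 * c false) <= eta.
    rewrite mean_weight; apply: contr; first exact: qt.
    (* Once squared, the constraint of [sqrt_contraction] is rho lam_1 + rho (lam_0 - lam_1) q <= 1,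
       which is the drop condition cleared of its denominator. *)
    rewrite !sqr_sqrtr ?ltW//.
    case: y => s p; have := drop k s p.
    rewrite (drop_probE _ _ k s p) ltr_pdivlMr//; move: (drop_prob _ _ _ _) => q; nra.
  have alphaK : classKoo (fun s => Num.sqrt (rho * alpha2 s)).
    by apply: classKoo_sqrt; exact: classKoo_scale.
  have b0 s : 0 < s -> 0 < Num.sqrt (alpha1 s).
    by move=> s0; rewrite sqrtr_gt0; exact: (classK_gt0 halpha1.1).
  have xb x0 g k s : 0 < s -> s <= `|ncs_x f K g (fun _ => 0) x0 k| ->
      Num.sqrt (alpha1 s) <=
      Num.sqrt (rho * alpha2 `|x0|) * \prod_(j < k) c (g j).
    move=> s0 /(bound _ _ _ _ (ltW s0)) h.
    apply: le_trans (ler_wsqrtr h) _.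
    rewrite sqrtrM; last by rewrite mulr_ge0 ?(ltW hrho)// (classK_ge0 halpha2.1).
    apply: ler_wpM2l => //.
    elim: k {h} => [|k ih]; first by rewrite !big_ord0 sqrtr1.
    rewrite !big_ord_recr/= sqrtrM ?prodr_ge0// => [|i _]; last exact: ltW.
    by apply: ler_wpM2r.
  have [es lim0] := contraction_safety hchain gam_rv law gam_indep causal
    (fun i => sqrtr_ge0 _) eta01 contraction alphaK b0 xb.
  have /andP[eta0 eta1] := eta01.
  apply: (@ASES_ASAS _ _ _ _ _ _ eta) => //; first by rewrite ltW.
  by move=> x0; exact: lim0.
(* A drop probability is nonnegative, so the strict bound forces eta > rho lam_1 > 0. This needs
   some joint state, which exists because a probability space is nonempty. *)
have eta_gt0 : 0 < eta.
  have /set0P[w _] : [set: T] != set0.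
    apply/eqP => T0; have := probability_setT P; rewrite T0 measure0 => /eqP.
    by rewrite eq_sym onee_eq0.
  have := drop 0 (sp 0 w).1 (sp 0 w).2; rewrite (drop_probE _ _ 0 _ (sp 0 w).2).
  move=> /(le_lt_trans (drop_prob_ge0 mu theta01 0 _)).
  rewrite pmulr_lgt0 ?invr_gt0// subr_gt0; apply: lt_trans.
  by rewrite mulr_gt0.
have contraction k y : \sum_y' joint_trans mu k y y' *
    ((1 - theta y'.1 y'.2) * (rho * lam true) +
     theta y'.1 y'.2 * (rho * lam false)) <= eta.
  rewrite (mean_weight mu theta k y (fun i => rho * lam i)).
  case: y => s p; have := drop k s p.
  rewrite (drop_probE _ _ k s p) ltr_pdivlMr//; move: (drop_prob _ _ _ _) => q; nra.
have alphaK : classKoo (fun s => rho * alpha2 s) by exact: classKoo_scale.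
have eta01 : 0 < eta < 1 by rewrite eta_gt0.
by have [] := contraction_safety hchain gam_rv law gam_indep causal
  (fun i => ltW (rl0 i)) eta01 contraction alphaK
  (fun s => classK_gt0 halpha1.1) (fun x0 g k s s0 => bound g x0 k s (ltW s0)).
Qed.
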